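(* Let $H$ be a real Hilbert space, $N$ a positive integer, $\Lambda = \{i \in \mathbb{N} : 1 \leq i \leq N\}$, $S_i \colon H \to H$ a strongly quasinonexpansive mapping for each $i \in \Lambda$, and $F = \bigcap_{i \in \Lambda} \operatorname{F}(S_i)$ the set of common fixed points of $\{S_i\}_{i \in \Lambda}$. Suppose that $F$ is nonempty and $\hat{\operatorname{F}}(S_i) = \operatorname{F}(S_i)$ for all $i \in \Lambda$. Let $\{x_n\}$ be a sequence defined by $x_1 \in H$ and $$ \begin{cases} i_n \in \arg\max \{ \lVert S_i x_n - x_n \rVert : i \in \Lambda \}; \\ x_{n+1} = S_{i_n} x_n \end{cases} $$ for $n \in \mathbb{N}$ (where $i_n$ is any choice of an element of the indicated set). Then $\{x_n\}$ converges weakly to the strong limit of $\{P_F(x_n)\}$; that is, the sequence $\{P_F(x_n)\}$ converges strongly, and $\{x_n\}$ converges weakly to its limit.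
   Context: $\mathbb{N}$ is the set of positive integers. For a mapping $T \colon C \to H$ defined on a nonempty subset $C$ of $H$ (here $C = H$): - $\operatorname{F}(T) = \{z \in C : Tz = z\}$ is the set of fixed points of $T$. - A point $z \in C$ is an asymptotic fixed point of $T$ if there exists a sequence $\{y_n\}$ in $C$ such that $y_n - T y_n \to 0$ strongly and $y_n \rightharpoonup z$ (weak convergence). The set of asymptotic fixed points of $T$ is denoted by $\hat{\operatorname{F}}(T)$. - $T$ is quasinonexpansive if $\operatorname{F}(T) \neq \emptyset$ and $\lVert Tx - z\rVert \leq \lVert x - z\rVert$ for all $x \in C$ and $z \in \operatorname{F}(T)$. If $C$ is closed and convex and $T$ is quasinonexpansive, then $\operatorname{F}(T)$ is closed and convex. - $T$ is strongly quasinonexpansive if $T$ is quasinonexpansive and $T y_n - y_n \to 0$ whenever $\{y_n\}$ is a bounded sequence in $C$ and $\lVert y_n - p\rVert - \lVert T y_n - p\rVert \to 0$ for some point $p \in \operatorname{F}(T)$. For a nonempty closed convex subset $D$ of $H$, $P_D$ denotes the metric projection of $H$ onto $D$: $P_D(x)$ is the unique point of $D$ with $\lVert x - P_D(x)\rVert = \min\{\lVert x-y\rVert : y \in D\}$. *)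

(* Defs.v *)
From HB Require Import structures.
From mathcomp Require Import all_boot all_order all_algebra sesquilinear.
From mathcomp Require Import all_classical all_reals all_analysis.

Set Implicit Arguments.
Unset Strict Implicit.
Unset Printing Implicit Defensive.

Import Order.TTheory GRing.Theory Num.Theory.
Import numFieldNormedType.Exports.

Local Open Scope classical_set_scope.
Local Open Scope ring_scope.

HB.mixin Record CompleteNormedModule_isHilbert (R : realType) H
    & CompleteNormedModule R H := {
  inner : {dot H for (idfun : R -> R)};
  inner_norm : forall x : H, inner x x = `|x| ^+ 2
}.

#[short(type="hilbertType")]
HB.structure Definition Hilbert (R : realType) :=
  {H of CompleteNormedModule R H & CompleteNormedModule_isHilbert R H}.

Section Definitions.
Context {R : realType} {H : hilbertType R}.
Implicit Types (T : H -> H) (D : set H) (x y : nat -> H) (z p : H).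

Definition weak_cvg x z : Prop :=
  forall f : {linear H -> R^o}, continuous f -> f (x n) @[n --> \oo] --> f z.

Definition Fix T : set H := [set z | T z = z].

Definition asymptotic_Fix T : set H :=
  [set z | exists y, y n - T (y n) @[n --> \oo] --> (0 : H) /\ weak_cvg y z].

Definition quasinonexpansive T : Prop :=
  Fix T !=set0 /\ forall z p, Fix T p -> `|T z - p| <= `|z - p|.

Definition strongly_quasinonexpansive T : Prop :=
  quasinonexpansive T /\
  forall y, bounded_fun y ->
    (exists2 p, Fix T p &
       `|y n - p| - `|T (y n) - p| @[n --> \oo] --> (0 : R)) ->
    T (y n) - y n @[n --> \oo] --> (0 : H).

(* For D nonempty, closed and convex the set below is a singleton, so the
   default value 0 is not used. *)
Definition metric_proj D z : H :=
  xget 0 [set p | D p /\ forall q, D q -> `|z - p| <= `|z - q|].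

End Definitions.

Definition argmax (R : realType) (I : Type) (g : I -> R) : set I :=
  [set i | forall j, g j <= g i].

(* Main.v *)
(* Fejer monotonicity of x with respect to F makes P_F(x_n) a Cauchy sequence,
   by the parallelogram law; call its limit u.  Since |x_n - p| converges for p
   in F, strong quasinonexpansiveness of the finitely many maps gives
   S_{i_n} x_n - x_n -> 0, hence x_n - S_j x_n -> 0 for every j because i_n
   maximizes the residual.  So every weak subsequential limit z of x lies in F,
   and the obtuse angle property <x_n - P_F x_n, z - P_F x_n> <= 0 passes to the
   limit as |z - u|^2 <= 0, i.e. z = u.  Bounded sequences having weakly
   convergent subsequences, x converges weakly to u.  Weak sequential compactness
   is obtained from the limit functional along an ultrafilter and the Riesz
   representation theorem. *)
Require Import Defs.
From HB Require Import structures.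
From mathcomp Require Import all_boot all_order all_algebra sesquilinear.
From mathcomp Require Import all_classical all_reals all_analysis.
From mathcomp Require Import ring lra.

Import Order.TTheory GRing.Theory Num.Theory.
Import numFieldNormedType.Exports.

Local Open Scope classical_set_scope.
Local Open Scope ring_scope.

Lemma cvg_dist_le (R : realType) (V : normedModType R) (T : Type)
    (A : set_system T) (FA : Filter A) (u : T -> V) (l : V) (v : T -> R) :
  (forall n, `|u n - l| <= v n) -> v n @[n --> A] --> (0 : R) ->
  u n @[n --> A] --> l.
Proof.
move=> uv v0; apply/subr_cvg0/norm_cvg0P.
apply: (@squeeze_cvgr _ _ _ _ (cst 0) v) => //; last exact: cvg_cst.
by apply: nearW => n /=; rewrite normr_ge0 uv.
Qed.

(* [inner] is only a projection to a bundled bilinear form, whose occurrences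
   come with distinct but convertible carriers; [dotp] gives rewriting a rigid
   head symbol. *)
Definition dotp (R : realType) (H : hilbertType R) (x y : H) : R := inner x y.
Arguments dotp {R H} x y : simpl never.
Local Notation "''[' x , y ]" := (dotp x y) : ring_scope.

(** * Inner product identities and a Cauchy criterion *)

Section InnerProduct.
Context {R : realType} {H : hilbertType R}.
Implicit Types (x y z a : H).

Lemma dotpp x : '[x, x] = `|x| ^+ 2.
Proof. exact: inner_norm. Qed.

Lemma dotpC x y : '[x, y] = '[y, x].
Proof. by rewrite /dotp hermC expr0 mul1r. Qed.

Lemma dotpDl x y z : '[x + y, z] = '[x, z] + '[y, z].
Proof. exact: linearDl. Qed.

Lemma dotpZl (k : R) x y : '[k *: x, y] = k * '[x, y].
Proof. exact: linearZl_LR. Qed.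

Lemma dotpDr x y z : '[x, y + z] = '[x, y] + '[x, z].
Proof. by rewrite !(dotpC x) dotpDl. Qed.

Lemma dotpZr (k : R) x y : '[x, k *: y] = k * '[x, y].
Proof. by rewrite !(dotpC x) dotpZl. Qed.

Lemma dotpNl x y : '[- x, y] = - '[x, y].
Proof. by rewrite -scaleN1r dotpZl mulN1r. Qed.

Lemma dotpNr x y : '[x, - y] = - '[x, y].
Proof. by rewrite -scaleN1r dotpZr mulN1r. Qed.

Definition dotpE := (dotpDl, dotpDr, dotpNl, dotpNr, dotpZl, dotpZr).

Lemma sqr_normB x y : `|x - y| ^+ 2 = `|x| ^+ 2 - 2 * '[x, y] + `|y| ^+ 2.
Proof. by rewrite -!dotpp !dotpE (dotpC y x); ring. Qed.

Lemma sqr_normD x y : `|x + y| ^+ 2 = `|x| ^+ 2 + 2 * '[x, y] + `|y| ^+ 2.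
Proof. by rewrite -!dotpp !dotpE (dotpC y x); ring. Qed.

(** The squared norms of [|y| x - |x| y] and [|y| x + |x| y] are nonnegative; expanding them and
    dividing by [|x| |y|] bounds the inner product from both sides. *)
Lemma cauchy_schwarz x y : `|'[x, y]| <= `|x| * `|y|.
Proof.
have [->|x0] := eqVneq x 0; first
  by rewrite -(scale0r 0) dotpZl mul0r !normr0 mulr_ge0.
have [->|y0] := eqVneq y 0; first
  by rewrite -(scale0r 0) dotpZr mul0r !normr0 mulr_ge0.
have xy_gt0 : 0 < `|x| * `|y| by rewrite mulr_gt0 ?normr_gt0.
have B : 0 <= `| `|y| *: x - `|x| *: y| ^+ 2 by rewrite sqr_ge0.
have D : 0 <= `| `|y| *: x + `|x| *: y| ^+ 2 by rewrite sqr_ge0.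
move: B D; rewrite sqr_normB sqr_normD !dotpE !normrZ !normr_id.
rewrite ler_norml => B D; apply/andP; split; rewrite -(ler_pM2l xy_gt0); nra.
Qed.

Lemma continuous_dotpl a : continuous (fun x => '[x, a]).
Proof.
move=> x; apply: (@cvg_dist_le _ R^o _ _ _ _ _ (fun y : H => `|y - x| * `|a|)).
  by move=> y; rewrite -dotpNl -dotpDl; exact: cauchy_schwarz.
rewrite -(mul0r `|a|); apply: cvgM; last exact: cvg_cst.
by apply/norm_cvg0P/subr_cvg0; exact: cvg_id.
Qed.

(** Serves minimizing sequences and projections of Fejer monotone sequences; in the latter case the
    estimate relies on [n <= m]. *)
Lemma sqr_dist_cvg (q : nat -> H) (e : nat -> R) :
  (forall n m, (n <= m)%N -> `|q n - q m| ^+ 2 <= e n + e m) ->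
  e n @[n --> \oo] --> (0 : R) -> cvgn q.
Proof.
move=> qe e0; apply/cauchy_cvgP/cauchy_exP => eps eps0.
have h0 : 0 < eps ^+ 2 / 2 by rewrite divr_gt0 ?exprn_gt0.
have [N _ eN] := cvgr_lt 0 e0 _ h0.
exists (q N), N => // m /= Nm; rewrite -ball_normE /=.
rewrite -ltr_sqr ?nnegrE ?(ltW eps0) //.
apply: le_lt_trans (qe _ _ Nm) _.
by have := eN N (leqnn N); have := eN m Nm; rewrite /=; lra.
Qed.

End InnerProduct.

(** * Nearest points, orthogonal decomposition and Riesz representation *)

Section Projection.
Context {R : realType} {H : hilbertType R}.
Implicit Types (D W : set H) (x y z a p q : H).

Definition convex_subset D :=
  forall p q (t : R), 0 <= t <= 1 -> D p -> D q -> D (p + t *: (q - p)).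

(** Parallelogram law for [z - p] and [z - q], whose half-sum is [z] minus the midpoint of [p] and
    [q]. *)
Lemma parallelogram_midpoint_le z p q (d : R) :
  0 <= d -> d <= `|z - (p + 2^-1 *: (q - p))| ->
  `|p - q| ^+ 2 <= 2 * (`|z - p| ^+ 2 - d ^+ 2) + 2 * (`|z - q| ^+ 2 - d ^+ 2).
Proof.
move=> d0; rewrite -ler_sqr ?nnegrE // opprD addrA.
have -> : q - p = (z - p) - (z - q) by rewrite opprB [RHS]addrC addrA subrK.
have -> : p - q = (z - q) - (z - p) by rewrite opprB [RHS]addrC addrA subrK.
move: (z - p) (z - q) => u v.
rewrite !sqr_normB normrZ exprMn sqr_normB !dotpE dotpp (dotpC v u).
by rewrite ger0_norm ?invr_ge0//; lra.
Qed.

(** A minimizing sequence is Cauchy: midpoints of its terms stay in [D], hence at distance at least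
    [d] from [z]. *)
Lemma nearest_point_exists D z : closed D -> convex_subset D -> D !=set0 ->
  exists p, D p /\ forall q, D q -> `|z - p| <= `|z - q|.
Proof.
move=> Dcl Dcvx [p0 Dp0].
pose E := [set `|z - p| | p in D]; pose d := inf E.
have Elb : has_lbound E by exists 0 => _ [p _ <-].
have Einf : has_inf E by split => //; exists `|z - p0|, p0.
have d_le q : D q -> d <= `|z - q| by move=> Dq; apply: ge_inf => //; exists q.
have d0 : 0 <= d by apply: lb_le_inf; [case: Einf | move=> _ [p _ <-]].
have /choice[q qP] (n : nat) : exists q, D q /\ `|z - q| < d + n.+1%:R^-1.
  have n0 : 0 < n.+1%:R^-1 :> R by rewrite invr_gt0.
  by have [_ [p Dp <-] pd] := inf_adherent n0 Einf; exists p.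
have Hd : `|z - q n| @[n --> \oo] --> d.
  apply: (@cvg_dist_le _ R^o _ _ _ _ _ harmonic); last exact: cvg_harmonic.
  move=> n; have [Dq qd] := qP n; rewrite ger0_norm ?subr_ge0 ?d_le //=.
  by rewrite lerBlDl ltW.
have qc : cvgn q.
  apply: (@sqr_dist_cvg _ _ _ (fun n => 2 * (`|z - q n| ^+ 2 - d ^+ 2))).
    move=> n m _; apply: parallelogram_midpoint_le => //; apply: d_le.
    by apply: Dcvx; [lra | case: (qP n) | case: (qP m)].
  rewrite -(mulr0 2) -(subrr (d ^+ 2)); apply: cvgM; first exact: cvg_cst.
  apply: cvgB; last exact: cvg_cst.
  by rewrite !expr2; under eq_fun do rewrite expr2; exact: cvgM.
exists (limn q); split.
  by apply: (closed_cvg D Dcl _ _ qc); apply: nearW => n; case: (qP n).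
move=> r Dr; suff -> : `|z - limn q| = d by exact: d_le.
have Hl : `|z - q n| @[n --> \oo] --> `|z - limn q|.
  by apply: cvg_norm; apply: cvgB qc; exact: cvg_cst.
exact: (cvg_unique _ Hl Hd).
Qed.

Lemma metric_projP D z : closed D -> convex_subset D -> D !=set0 ->
  D (metric_proj D z) /\ forall q, D q -> `|z - metric_proj D z| <= `|z - q|.
Proof.
move=> Dcl Dcvx D0; have [p pP] := nearest_point_exists D z Dcl Dcvx D0.
exact: (@xgetPex _ 0 [set p | D p /\ forall q, D q -> `|z - p| <= `|z - q|]
  (ex_intro _ p pP)).
Qed.

(** Comparing [p] with the points of the segment towards [q] bounds [2 t c] by [t ^+ 2 m], which
    fails for small [t > 0] if [c > 0]. *)
Lemma nearest_point_obtuse D z p q : convex_subset D -> D p ->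
  (forall r, D r -> `|z - p| <= `|z - r|) -> D q -> '[z - p, q - p] <= 0.
Proof.
move=> Dcvx Dp pP Dq; rewrite leNgt; apply/negP => c0.
set c := '[_, _] in c0; pose m := `|q - p| ^+ 2.
have ineq (t : R) : 0 <= t <= 1 -> 2 * (t * c) <= t ^+ 2 * m.
  move=> t01; have := pP _ (Dcvx _ _ _ t01 Dp Dq).
  rewrite -ler_sqr ?nnegrE// opprD addrA (sqr_normB (z - p)) dotpZr -/c.
  by rewrite normrZ exprMn -/m real_normK ?num_real// => ?; lra.
have m0 : 0 <= m by rewrite sqr_ge0.
(* The test value is [t = c / m], the minimizer of [t ^+ 2 m - 2 t c], cut off at [1]. *)
have [cm|mc] := leP c m.
  have m_gt0 : 0 < m by exact: lt_le_trans cm.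
  have : 0 <= c / m <= 1 by rewrite divr_ge0 ?(ltW c0)//= ler_pdivrMr// mul1r.
  move=> /ineq; have -> : (c / m) ^+ 2 * m = c / m * c by field; rewrite gt_eqF.
  by have := mulr_gt0 (divr_gt0 c0 m_gt0) c0; lra.
by have := ineq 1; rewrite ler01 lexx => /(_ isT); lra.
Qed.

(** Take for [w] the point of [W] nearest to [a]; the obtuse angle inequality at [w + v] and at
    [w - v] gives both signs. *)
Lemma orthogonal_decomposition W a : closed W -> W 0 ->
  (forall x y, W x -> W y -> W (x + y)) ->
  (forall (k : R) x, W x -> W (k *: x)) ->
  exists2 w, W w & forall v, W v -> '[a - w, v] = 0.
Proof.
move=> Wcl W0 WD WZ.
have WN x : W x -> W (- x) by rewrite -scaleN1r => /WZ.
have Wcvx : convex_subset W.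
  by move=> p q t _ Wp Wq; apply: (WD) => //; apply/WZ/WD/WN.
have [w [Ww wP]] := nearest_point_exists W a Wcl Wcvx (ex_intro _ 0 W0).
exists w => // v Wv; apply/eqP; rewrite eq_le; apply/andP; split.
  have := nearest_point_obtuse W a w (w + v) Wcvx Ww wP (WD _ _ Ww Wv).
  by rewrite [w + v]addrC addrK.
have := nearest_point_obtuse W a w (w - v) Wcvx Ww wP (WD _ _ Ww (WN _ Wv)).
by rewrite [w - v]addrC addrK dotpNr oppr_le0.
Qed.

(** Let [e] be orthogonal to the kernel with [f e != 0]. Since [a - (f a / f e) e] lies in the
    kernel, pairing it with [e] expresses [f a] through ['[a, e]]. *)
Lemma riesz_representation (f : {linear H -> R^o}) : continuous f ->
  exists z, forall a, f a = '[a, z].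
Proof.
move=> fc; have [f0|] := pselect (forall b, f b = 0).
  by exists 0 => a; rewrite -(scale0r 0) dotpZr mul0r.
move=> /existsNP[b /eqP fb0].
have Kcl : closed [set a | f a = 0].
  have -> : [set a | f a = 0] = f @^-1` [set 0 : R^o] by [].
  by apply: preimage_closed => [x _|]; [exact: fc | exact: closed_eq].
have [|||w /= fw wP] := orthogonal_decomposition [set a | f a = 0] b Kcl.
- exact: linear0.
- by move=> x y /= fx fy; rewrite linearD fx fy addr0.
- by move=> k x /= fx; rewrite linearZ /= fx; exact: scaler0.
set e := b - w in wP.
have fe0 : f e != 0 by rewrite /e linearB /= fw subr0.
have e0 : '[e, e] != 0.
  by rewrite dotpp expf_eq0 normr_eq0; apply: contra fe0 => /eqP ->;
    rewrite linear0.
clearbody e; exists ((f e / '[e, e]) *: e) => a.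
have : '[e, a - (f a / f e) *: e] = 0.
  by apply: wP => /=; rewrite linearB linearZ /= /GRing.scale /= divfK ?subrr.
rewrite !dotpE (dotpC e a) => /eqP; rewrite subr_eq0 => /eqP ->.
by field; rewrite fe0 e0.
Qed.

End Projection.

(** * Weak sequential compactness by way of ultrafilters *)

(** Subsequences are taken along index maps with [k <= s k], a condition that pointwise choice
    provides and that composition preserves. *)
Lemma leq_id_cvgny (s : nat -> nat) :
  (forall k, (k <= s k)%N) -> s k @[k --> \oo] --> \oo.
Proof.
by move=> sk; apply/cvgnyPge => A; exists A => // k /= Ak;
  exact: leq_trans (sk k).
Qed.

(** Compactness of [[-M, M]] gives a cluster point of the image of [U], and an ultrafilter converges
    to each of its cluster points. *)
Lemma ultra_bounded_cvg (R : realType) (T : Type) (U : set_system T)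
    (UU : UltraFilter U) (u : T -> R) (M : R) :
  (forall n, `|u n| <= M) -> exists l : R, u n @[n --> U] --> l.
Proof.
move=> uM; have UP : ProperFilter U by exact: ultra_proper.
have uI : (u n @[n --> U]) `[- M, M]%classic.
  by apply: (@filterE _ U) => n /=; rewrite in_itv /= -ler_norml.
have [l [_ lcl]] := @segment_compact R (- M) M _ _ uI; exists l => B lB.
have [//|BC] := in_ultra_setVsetC (u @^-1` B) UU.
by have [r []] : (~` B) `&` B !=set0 by exact: lcl.
Qed.

Section WeakCompactness.
Context {R : realType} {H : hilbertType R}.
Implicit Types (x y : nat -> H) (z a : H).

Lemma weak_cvgP y z :
  weak_cvg y z <-> forall a, '[y n, a] @[n --> \oo] --> '[z, a].
Proof.
split=> [yz a|yz f fc].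
  have lin : linear (fun u => '[u, a] : R^o) by move=> k u v; rewrite !dotpE.
  pose f : {linear H -> R^o} := HB.pack (fun u => '[u, a] : R^o)
    (GRing.isLinear.Build R H R^o *:%R _ lin).
  by apply: (yz f) => u; exact: continuous_dotpl.
have [a fa] := riesz_representation f fc.
by rewrite fa; under eq_fun do rewrite fa; exact: yz.
Qed.

(** Along [U] the scalars ['[x n, a]] converge for all [a] at once, without diagonal extraction;
    their limits form a bounded linear functional of [a]. *)
Lemma ultra_weak_cvg (T : Type) (U : set_system T) (UU : UltraFilter U)
    (x : T -> H) (M : R) : (forall n, `|x n| <= M) ->
  exists z, forall a, '[x n, a] @[n --> U] --> '[z, a].
Proof.
move=> xM; have UP : ProperFilter U by exact: ultra_proper.
have /choice[l lP] a : exists l : R, '[x n, a] @[n --> U] --> l.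
  apply: (ultra_bounded_cvg _ _ _ _ _ (M * `|a|)) => n.
  by rewrite (le_trans (cauchy_schwarz _ _))// ler_wpM2r.
have l_lin : linear (l : H -> R^o).
  move=> k u v.
  have klim : '[x n, k *: u + v] @[n --> U] --> k * l u + l v.
    under eq_fun do rewrite dotpDr dotpZr.
    by apply: cvgD => //; apply: cvgM => //; exact: cvg_cst.
  exact: (cvg_unique _ (lP _) klim).
have l_le a : `|l a| <= `|a| * M.
  have lN : `|'[x n, a]| @[n --> U] --> `|l a| by apply: cvg_norm; exact: lP.
  apply: (closed_cvg _ (@closed_le R (`|a| * M)) _ _ lN).
  apply: nearW => n /=; rewrite mulrC.
  by rewrite (le_trans (cauchy_schwarz _ _))// ler_wpM2r.
pose f : {linear H -> R^o} := HB.pack (l : H -> R^o)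
  (GRing.isLinear.Build R H R^o *:%R _ l_lin).
have fc : continuous f.
  move=> a; apply: (@cvg_dist_le _ R^o _ _ _ _ _ (fun b : H => `|b - a| * M)).
    by move=> b; have <- := linearB f b a; exact: l_le.
  rewrite -(mul0r M); apply: cvgM; last exact: cvg_cst.
  by apply/norm_cvg0P/subr_cvg0; exact: cvg_id.
have [z fz] := riesz_representation f fc.
by exists z => a; rewrite dotpC -fz; exact: lP.
Qed.

(* The vectors on which the functionals [y n - z] tend to 0 form a closed
   subspace [W] containing every [y m - z], so they vanish identically on the
   orthogonal complement of [W]. *)
Lemma weak_cvg_range y z (M : R) : (forall n, `|y n| <= M) ->
  (forall m, '[y n - z, y m] @[n --> \oo] --> (0 : R)) ->
  '[y n - z, z] @[n --> \oo] --> (0 : R) ->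
  weak_cvg y z.
Proof.
move=> yM yy yz; apply/weak_cvgP => a.
pose W := [set a | '[y n - z, a] @[n --> \oo] --> (0 : R)].
have WZ (k : R) u : W u -> W (k *: u).
  move=> Wu; rewrite /W /=; under eq_fun do rewrite dotpZr.
  by rewrite -(mulr0 k); apply: cvgM => //; exact: cvg_cst.
have WD u v : W u -> W v -> W (u + v).
  move=> Wu Wv; rewrite /W /=; under eq_fun do rewrite dotpDr.
  by rewrite -(addr0 0); exact: cvgD.
have W0 : W 0 by rewrite -(scale0r z); exact: WZ.
have Wcl : closed W.
  move=> u uW; apply/cvgr0Pnorm_le => e e0.
  (* [C] bounds every [|y n - z|], and the summand [1] makes it positive; replacing [u] by a [v] in
     [W] within [e / 2 / C] then costs at most [e / 2]. *)
  pose C := M + `|z| + 1.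
  have C0 : 0 < C by rewrite ltr_wpDl// addr_ge0 ?(le_trans _ (yM 0%N)).
  have yC n : `|y n - z| <= C.
    by rewrite (le_trans (ler_normB _ _))// /C; have := yM n; lra.
  have e2 : 0 < e / 2 by rewrite divr_gt0.
  have [v [Wv /= uv]] := uW _ (nbhsx_ballx u (e / 2 / C) (divr_gt0 e2 C0)).
  move: uv; rewrite -ball_normE /= ltr_pdivlMr// => uv.
  near=> n.
  have -> : u = v + (u - v) by rewrite addrC subrK.
  rewrite dotpDr (splitr e) (le_trans (ler_normD _ _))// lerD//.
    by near: n; exact: cvgr0_norm_le.
  rewrite (le_trans (cauchy_schwarz _ _))// mulrC ltW// (le_lt_trans _ uv)//.
  by rewrite ler_wpM2l.
have [w Ww wP] := orthogonal_decomposition W a Wcl W0 WD WZ.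
have ya n : '[y n, a] - '[z, a] = '[y n - z, w].
  rewrite -dotpNl -dotpDl -{1}(subrK w a) dotpDr (dotpC _ (a - w)) wP ?add0r//.
  by apply: (WD); [exact: yy | rewrite -scaleN1r; exact: WZ].
apply/subr_cvg0; under eq_fun do rewrite ya.
exact: Ww.
Unshelve. all: by end_near. Qed.

Lemma bounded_weak_subseq x (M : R) : (forall n, `|x n| <= M) ->
  exists z (s : nat -> nat), (forall k, (k <= s k)%N) /\ weak_cvg (x \o s) z.
Proof.
move=> xM; have [U [UU ooU]] := ultraFilterLemma eventually_filter.
have UP : ProperFilter U by exact: ultra_proper.
have [z xz] := ultra_weak_cvg _ U UU x M xM.
have xz0 a : '[x n - z, a] @[n --> U] --> (0 : R).
  under eq_fun do rewrite dotpDl dotpNl.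
  by apply/subr_cvg0; exact: xz.
(* Stage [k] imposes finitely many conditions, each true on a set of [U]: [x (s k) - z] is nearly
   orthogonal to [z] and to [x 0], ..., [x k]. *)
have /choice[s sP] k : exists n, [/\ (k <= n)%N,
    forall m : 'I_k.+1, `|'[x n - z, x m]| < k.+1%:R^-1 &
    `|'[x n - z, z]| < k.+1%:R^-1].
  have k0 : 0 < k.+1%:R^-1 :> R by rewrite invr_gt0.
  apply: (@filter_ex _ U); near=> n; split; near: n.
  - by apply: ooU; exists k.
  - by apply: filter_forall => m; exact: cvgr0_norm_lt.
  - exact: cvgr0_norm_lt.
exists z, s; split; first by move=> k; case: (sP k).
apply: weak_cvg_range => [n|m|]; first exact: xM.
  rewrite /=; apply/subr_cvg0/norm_cvg0P.
  apply: (@squeeze_cvgr _ _ _ _ (cst 0) harmonic) cvg_harmonic; last first.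
    exact: cvg_cst.
  (* From stage [s m] on, [x (s m)] is among the vectors tested. *)
  exists (s m) => // n /= mn; rewrite normr_ge0 subr0 ltW//.
  have [_ /(_ (@Ordinal n.+1 (s m) mn))] := sP n; exact.
apply: (@cvg_dist_le _ R^o _ _ _ _ _ harmonic); last exact: cvg_harmonic.
by move=> n; rewrite subr0 ltW//; case: (sP n).
Unshelve. all: by end_near. Qed.

End WeakCompactness.

(** * Fixed point sets and Fejer monotone sequences *)

Section Fejer.
Context {R : realType} {H : hilbertType R}.
Implicit Types (D : set H) (x : nat -> H) (z p q : H) (T : H -> H).

(** Stewart's identity. *)
Lemma sqr_dist_segment z p q (t : R) :
  `|z - (p + t *: (q - p))| ^+ 2 =
  (1 - t) * `|z - p| ^+ 2 + t * `|z - q| ^+ 2 - t * (1 - t) * `|q - p| ^+ 2.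
Proof.
have -> : z - q = (z - p) - (q - p) by rewrite opprB addrA subrK.
rewrite opprD addrA; move: (z - p) (q - p) => u v.
by rewrite -!dotpp !dotpE (dotpC v u); ring.
Qed.

(* A point of a segment is determined by its distances to the endpoints. *)
Lemma quasinonexpansive_Fix_convex T :
  quasinonexpansive T -> convex_subset (Fix T).
Proof.
move=> [_ qT] p q t /andP[t0 t1] Fp Fq; set r := p + _.
apply/eqP; rewrite -subr_eq0 -normr_eq0 -sqrf_eq0 eq_le sqr_ge0 andbT.
(* Writing [0] as [|r - r| ^+ 2] lets the identity for the segment expand both sides, which are then
   compared term by term. *)
have rr : `|r - r| ^+ 2 = 0 by rewrite subrr normr0 expr0n.
rewrite -rr /r !sqr_dist_segment -/r lerD2r.
apply: lerD; apply: ler_wpM2l; rewrite ?subr_ge0// ler_sqr ?nnegrE//.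
  exact: qT.
exact: qT.
Qed.

(** For [q] fixed by [T], [|T p - p| <= |T p - q| + |q - p| <= 2 |p - q|], arbitrarily small when
    [p] is in the closure. *)
Lemma quasinonexpansive_Fix_closed T : quasinonexpansive T -> closed (Fix T).
Proof.
move=> [_ qT] p pF; apply/eqP; rewrite -subr_eq0 -normr_le0.
apply/ler_addgt0Pr => e e0; rewrite add0r.
have e2 : 0 < e / 2 by rewrite divr_gt0.
have [q [Fq]] := pF _ (nbhsx_ballx p (e / 2) e2).
rewrite -ball_normE /= => pq.
rewrite -(subrK q (T p)) -addrA (le_trans (ler_normD _ _))//.
by have := qT p q Fq; rewrite distrC; move: pq; rewrite (distrC q p); lra.
Qed.

Lemma fejer_le x p n m : (forall k, `|x k.+1 - p| <= `|x k - p|) ->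
  (n <= m)%N -> `|x m - p| <= `|x n - p|.
Proof.
move=> xp /subnK <-; elim: (m - n)%N => // k IH.
exact: le_trans (xp _) IH.
Qed.

Lemma fejer_dist_cvg x p : (forall k, `|x k.+1 - p| <= `|x k - p|) ->
  cvgn (fun n => `|x n - p|).
Proof.
move=> xp; apply: nonincreasing_is_cvgn; first by move=> n m; exact: fejer_le.
by exists 0 => _ [n _ <-].
Qed.

(** The midpoint estimate around [x m] gives [|q n - q m| ^+ 2 <= 2 (d n - d m)] for [n <= m], and
    [d] decreases to a limit. *)
Lemma fejer_metric_proj_cvg D x : closed D -> convex_subset D -> D !=set0 ->
  (forall p, D p -> forall n, `|x n.+1 - p| <= `|x n - p|) ->
  cvgn (fun n => metric_proj D (x n)).
Proof.
move=> Dcl Dcvx D0 xF; pose q n := metric_proj D (x n).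
have qP n := metric_projP D (x n) Dcl Dcvx D0.
have Dq n : D (q n) by case: (qP n).
pose d n := `|x n - q n| ^+ 2.
have d_mono n m : (n <= m)%N -> d m <= d n.
  move=> nm; rewrite ler_sqr ?nnegrE//; apply: (le_trans ((qP m).2 _ (Dq n))).
  by apply: fejer_le => //; exact: xF.
have dc : cvgn d.
  by apply: nonincreasing_is_cvgn => //; exists 0 => _ [n _ <-]; exact: sqr_ge0.
have d_ge m : limn d <= d m by exact: nonincreasing_cvgn_ge.
apply: (@sqr_dist_cvg _ _ _ (fun n => 2 * (d n - limn d))).
  move=> n m nm.
  have := @parallelogram_midpoint_le _ _ (x m) (q n) (q m) `|x m - q m|
    (normr_ge0 _) ((qP m).2 _ (Dcvx _ _ 2^-1 _ (Dq n) (Dq m))).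
  have -> : 0 <= (2^-1 : R) <= 1 by lra.
  move=> /(_ isT) qq; apply: (le_trans qq).
  have : `|x m - q n| ^+ 2 <= d n.
    by rewrite ler_sqr ?nnegrE//; apply: fejer_le => //; exact: xF.
  by have := d_ge m; rewrite /d; lra.
rewrite -(mulr0 2) -(subrr (limn d)); apply: cvgM; first exact: cvg_cst.
by apply: cvgB => //; exact: cvg_cst.
Qed.

(* By the obtuse angle property, [<x_n - P x_n, z - P x_n> <= 0]; along the
   subsequence this tends to [|z - u|^2]. *)
Lemma fejer_weak_limit D x u z (s : nat -> nat) (M : R) :
  closed D -> convex_subset D -> D z -> (forall n, `|x n| <= M) ->
  metric_proj D (x n) @[n --> \oo] --> u -> (forall k, (k <= s k)%N) ->
  weak_cvg (x \o s) z -> z = u.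
Proof.
move=> Dcl Dcvx Dz xM qu sk xz; pose q n := metric_proj D (x n).
have D0 : D !=set0 by exists z.
have qP n := metric_projP D (x n) Dcl Dcvx D0.
have qs : q (s k) @[k --> \oo] --> u.
  exact: (cvg_comp _ _ (leq_id_cvgny _ sk) qu).
have xs a : '[x (s k), a] @[k --> \oo] --> '[z, a] by exact: (weak_cvgP _ _).1.
have qa a : '[q (s k), a] @[k --> \oo] --> '[u, a].
  exact: (cvg_comp _ _ qs (continuous_dotpl a u)).
have lhs : '[x (s k), z - u] - '[q (s k), z - u] @[k --> \oo]
    --> '[z, z - u] - '[u, z - u] by exact: cvgB.
have qu0 : (M + `|z|) * `|q (s k) - u| @[k --> \oo] --> (0 : R).
  rewrite -(mulr0 (M + `|z|)); apply: cvgM; first exact: cvg_cst.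
  by apply/norm_cvg0P/subr_cvg0.
(* Split [z - u] at [q (s k)]: the obtuse angle property handles the first part, and Cauchy-Schwarz
   the second, with [|x (s k) - q (s k)| <= |x (s k) - z| <= M + |z|]. *)
have le k : '[x (s k), z - u] - '[q (s k), z - u] <=
    (M + `|z|) * `|q (s k) - u|.
  have [Dq qmin] := qP (s k); rewrite -/(q _) in Dq qmin.
  have -> : z - u = (z - q (s k)) + (q (s k) - u) by rewrite addrA subrK.
  have obt := nearest_point_obtuse _ _ _ _ Dcvx Dq qmin Dz.
  rewrite -dotpNl -dotpDl dotpDr -[leRHS]add0r lerD//.
  apply: (le_trans (ler_norm _)); apply: (le_trans (cauchy_schwarz _ _)).
  rewrite ler_wpM2r// (le_trans (qmin z Dz))// (le_trans (ler_normB _ _))//.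
  by rewrite lerD2r.
have := ler_lim (cvgP _ lhs) (cvgP _ qu0) (nearW _ le).
rewrite (cvg_lim _ lhs)// (cvg_lim _ qu0)// -dotpNl -dotpDl dotpp => zu.
by apply/eqP; rewrite -subr_eq0 -normr_eq0 -sqrf_eq0 eq_le zu sqr_ge0.
Qed.

End Fejer.

(** * Vanishing residuals of the selected maps *)

Section Selection.
Context {R : realType} {H : hilbertType R} {I : finType}.
Implicit Types (S : I -> H -> H) (x : nat -> H) (p : H) (i : nat -> I).

(* For each index [j], strong quasinonexpansiveness of [S j] is applied to the
   sequence equal to [x n] when [j] is selected and to [p] otherwise. *)
Lemma selected_residual_cvg0 S x i p :
  (forall j, strongly_quasinonexpansive (S j)) ->
  (forall j, Fix (S j) p) -> (forall n, x n.+1 = S (i n) (x n)) ->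
  S (i n) (x n) - x n @[n --> \oo] --> (0 : H).
Proof.
move=> hS Fp hx.
have xp n : `|x n.+1 - p| <= `|x n - p| by rewrite hx; exact: (hS _).1.2.
pose y j n := if i n == j then x n else p.
have gap0 : `|x n - p| - `|x n.+1 - p| @[n --> \oo] --> (0 : R).
  have xc := fejer_dist_cvg x p xp.
  rewrite -(subrr (limn (fun n => `|x n - p|))); apply: cvgB => //.
  by rewrite (cvg_shiftS (fun n => `|x n - p|)).
have y0 j : S j (y j n) - y j n @[n --> \oo] --> (0 : H).
  apply: (hS j).2.
    exists (`|x 0%N - p| + `|p|); split; first exact: num_real.
    move=> M /ltW cM n _ /=; apply: le_trans cM; rewrite /y.
    case: ifP => _; last by rewrite ler_wpDl.
    rewrite -[x n](subrK p) (le_trans (ler_normD _ _))// lerD2r.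
    exact: fejer_le.
  (* The decrease of the distance to [p] is that of [x] when [j] is selected and [0] otherwise. *)
  exists p => //; apply: (@cvg_dist_le _ R^o _ _ _ _ _ _ _ gap0) => n.
  rewrite subr0 /y; case: ifP => [/eqP <-|_].
    by rewrite -hx ger0_norm// subr_ge0.
  by rewrite (Fp j) subrr normr0 subr_ge0.
apply/cvgr0Pnorm_le => e e0.
(* As [I] is finite, one threshold serves all [j], so [j] may then be taken to be [i n]. *)
have ye : \forall n \near \oo, forall j, `|S j (y j n) - y j n| <= e.
  by apply: filter_forall => j; exact: cvgr0_norm_le.
by apply: filterS ye => n /(_ (i n)); rewrite /y eqxx.
Qed.

End Selection.

(* Indices are shifted by one: Lambda is 'I_N and x 0 is the initial point. *)
Theorem theorem4p2 (R : realType) (H : hilbertType R) (N : nat) (hN : (0 < N)%N)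
    (S : 'I_N -> H -> H)
    (hS : forall i, strongly_quasinonexpansive (S i))
    (F := \bigcap_i Fix (S i))
    (hF : F !=set0)
    (hSF : forall i, asymptotic_Fix (S i) = Fix (S i))
    (x : nat -> H) (i : nat -> 'I_N)
    (hi : forall n, argmax (fun j => `|S j (x n) - x n|) (i n))
    (hx : forall n, x n.+1 = S (i n) (x n)) :
  exists p : H,
    metric_proj F (x n) @[n --> \oo] --> p /\ weak_cvg x p.
Proof.
have Fcl : closed F.
  by apply: closed_bigI => j _; exact: quasinonexpansive_Fix_closed (hS j).1.
have Fcvx : convex_subset F.
  move=> p q t t01 Fp Fq j _.
  by apply: (quasinonexpansive_Fix_convex _ (hS j).1) => //;
    [exact: Fp | exact: Fq].
have xF p : F p -> forall n, `|x n.+1 - p| <= `|x n - p|.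
  by move=> Fp n; rewrite hx; apply: (hS _).1.2; exact: Fp.
have [p Fp] := hF.
have xM n : `|x n| <= `|x 0%N - p| + `|p|.
  rewrite -[x n](subrK p) (le_trans (ler_normD _ _))// lerD2r.
  by apply: fejer_le => //; exact: xF.
have res0 j : x n - S j (x n) @[n --> \oo] --> (0 : H).
  apply: (@cvg_dist_le _ _ _ _ _ _ _ (fun n => `|S (i n) (x n) - x n|)).
    by move=> n; rewrite subr0 distrC; exact: hi.
  apply/norm_cvg0P; apply: (selected_residual_cvg0 _ _ _ p) => // k; exact: Fp.
pose u := limn (fun n => metric_proj F (x n)).
have qu : metric_proj F (x n) @[n --> \oo] --> u.
  exact: fejer_metric_proj_cvg.
have weak_limit (s : nat -> nat) z :
    (forall k, (k <= s k)%N) -> weak_cvg (x \o s) z -> z = u.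
  move=> sk xz; apply: (fejer_weak_limit _ _ _ _ _ _ Fcl Fcvx _ xM qu sk xz).
  (* The subsequence itself witnesses that [z] is an asymptotic fixed point of each [S j]. *)
  move=> j _; rewrite -hSF; exists (x \o s); split=> //.
  exact: (cvg_comp _ _ (leq_id_cvgny _ sk) (res0 j)).
exists u; split => //; apply/weak_cvgP => a; apply/cvgrPdist_lt => e e0.
(* Otherwise [t] selects terms whose pairing with [a] stays [e] away from that of [u], yet a further
   subsequence of them converges weakly, necessarily to [u]. *)
apply: contrapT => nlim.
have /choice[t tP] k : exists n, (k <= n)%N /\ e <= `|dotp u a - dotp (x n) a|.
  apply: contrapT => nk; apply: nlim; exists k => // n /= kn.
  by rewrite ltNge; apply/negP => en; apply: nk; exists n.
have [z [s [sk xz]]] := bounded_weak_subseq (x \o t) _ (fun n => xM (t n)).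
have zu : z = u.
  apply: (weak_limit (t \o s)) => // k.
  exact: leq_trans (sk k) (tP (s k)).1.
move/weak_cvgP/(_ a): xz; rewrite zu => /cvgrPdist_lt/(_ e e0).
move=> [k _ /(_ k (leqnn k))].
by rewrite /= ltNge (tP (s k)).2.
Qed.
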